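(* Let $T_1^\infty$ be the doubly infinite comb: the tree consisting of a two-way infinite path $(\dots,x_{-1},x_0,x_1,\dots)$ together with, for each $i\in\mathbb{Z}$, a new leaf $y_i$ adjacent only to $x_i$. Then $T_1^\infty$ is a locally finite, $\hat{T}$-free tree with $\zeta(T_1^\infty)=2$.
   Context: $\hat{T}$ is the finite tree on 10 vertices consisting of a root $r$ with three children $a,b,c$, each of which has exactly two children that are leaves. A graph is $H$-free if it does not contain $H$ as an induced subgraph. The Localization game on a graph $G$ with $k$ cops: the robber moves first, occupying a vertex; in each later robber move the robber moves to a neighboring vertex or stays put. On each cop move, the cops choose vertices $u_1,\dots,u_k$ (arbitrary) and learn the distances $d_i$ from each $u_i$ to the robber's current vertex. The cops capture the robber if after finitely many rounds they can determine the robber's vertex uniquely; otherwise the robber wins. The robber is omniscient. The localization number $\zeta(G)$ is the smallest cardinal $k$ such that $k$ cops have a winning strategy. *)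

(* Defs.v *)
(* Mathematical Components, with the classical layer of MathComp-Analysis. *)
From mathcomp Require Import all_boot all_order all_algebra.
From mathcomp Require Import boolp classical_sets functions cardinality.
Set Implicit Arguments.
Unset Strict Implicit.
Unset Printing Implicit Defensive.
Import Order.TTheory GRing.Theory Num.Theory.
Local Open Scope ring_scope.

Record sgraph := SGraph {
  vertex :> eqType;
  adj : rel vertex;
  adj_sym : symmetric adj;
  adj_irrefl : irreflexive adj }.

Section Graphs.
Variable G : sgraph.

Definition connected_graph : Prop :=
  forall x y : G, exists2 p, path (@adj G) x p & last x p = y.

(* [ucycle] accepts closed walks of length at most 2 along an edge, which are
   not cycles of a simple graph; hence the size bound. *)
Definition acyclic_graph : Prop :=
  forall c : seq G, ucycle (@adj G) c -> (size c <= 2)%N.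

Definition is_tree : Prop :=
  [/\ inhabited G, connected_graph & acyclic_graph].

Definition locally_finite : Prop :=
  forall x : G, finite_set [set y | adj x y]%classic.

Definition walk_length (x y : G) : pred nat := fun n =>
  `[< exists p, [/\ path (@adj G) x p, last x p = y & size p = n] >].

(* [None] stands for the infinite distance between different components. *)
Definition dist (x y : G) : option nat :=
  if pselect (exists n, walk_length x y n) is left h then Some (ex_minn h)
  else None.

End Graphs.

Definition induced_free (H G : sgraph) : Prop :=
  ~ exists2 f : H -> G, injective f & forall x y, adj (f x) (f y) = adj x y.

Section LocalizationGame.
Variables (G : sgraph) (K : Type).

Definition answer := K -> option nat.

(* The cops are indexed by [K].  Since a strategy is deterministic, the past
   probes are recovered from the past answers, so the next probes are a function
   of the past answers only (in chronological order). *)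
Definition cop_strategy := seq answer -> K -> G.

Definition robber_play (r : nat -> G) : Prop :=
  forall n, r n.+1 = r n \/ adj (r n) (r n.+1).

Fixpoint answers (s : cop_strategy) (r : nat -> G) (n : nat) : seq answer :=
  if n is m.+1 then
    let h := answers s r m in rcons h (fun j => dist (s h j) (r m))
  else [::].

(* After the probe made while the robber is at [r n], every play that is
   consistent with all answers received so far has the robber at [r n]. *)
Definition located (s : cop_strategy) (r : nat -> G) (n : nat) : Prop :=
  forall r', robber_play r' -> answers s r' n.+1 = answers s r n.+1 ->
    r' n = r n.

(* An omniscient robber knows the strategy in advance, so a winning strategy
   has to succeed against every play; the number of rounds needed may depend on
   the play. *)
Definition cops_win : Prop :=
  exists s : cop_strategy,
    forall r, robber_play r -> exists n, located s r n.

End LocalizationGame.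

(* The localization number of [G] is the cardinality of the type [K]. *)
Definition localization_number_is (G : sgraph) (K : Type) : Prop :=
  cops_win G K /\
  forall L : Type, cops_win G L -> ([set: K] #<= [set: L])%card.

(* r = 0; a, b, c = 1, 2, 3; the leaves are 4, ..., 9. *)
Definition hatT_edges : seq (nat * nat) :=
  [:: (0, 1); (0, 2); (0, 3); (1, 4); (1, 5); (2, 6); (2, 7); (3, 8); (3, 9)]%N.

Definition hatT_adj : rel 'I_10 := fun i j =>
  ((val i, val j) \in hatT_edges) || ((val j, val i) \in hatT_edges).

Lemma hatT_adj_sym : symmetric hatT_adj.
Proof. by move=> i j; rewrite /hatT_adj orbC. Qed.

Lemma hatT_adj_irrefl : irreflexive hatT_adj.
Proof. by case; do 10?[case=> //]. Qed.

Definition hatT : sgraph := SGraph hatT_adj_sym hatT_adj_irrefl.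

(* [inl i] is the spine vertex x_i and [inr i] is the leaf y_i. *)
Definition comb_adj : rel (int + int)%type := fun u v =>
  match u, v with
  | inl i, inl j => (j == i + 1) || (i == j + 1)
  | inl i, inr j => i == j
  | inr i, inl j => i == j
  | inr _, inr _ => false
  end.

Lemma comb_adj_sym : symmetric comb_adj.
Proof. by move=> [i|i] [j|j] //=; rewrite 1?orbC 1?eq_sym // eq_sym. Qed.

Lemma comb_adj_irrefl : irreflexive comb_adj.
Proof. by move=> [i|i] //=; rewrite orbb -subr_eq0 opprD addNKr. Qed.

Definition comb : sgraph := SGraph comb_adj_sym comb_adj_irrefl.

(* Main.v *)
(** One cop cannot win: from a spine vertex x_i the robber can reach x_(i-1),
    x_(i+1) and y_i, and every vertex of the comb is equidistant from two of
    these three.  At least one of the two is on the spine, so a robber who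
    always moves to such a vertex is confused with another possible move at
    every round and can go on forever.

    Two cops win in two rounds: probing x_0 bounds the distance d of the robber
    from x_0, and after his next move he is between the spine vertices
    x_(-d-2) and x_(d+2), whose distances to him determine his position. *)
Require Import Defs.
From mathcomp Require Import all_boot.
From mathcomp Require Import all_order all_algebra zify.
From mathcomp Require Import boolp classical_sets functions cardinality.
Set Implicit Arguments.
Unset Strict Implicit.
Unset Printing Implicit Defensive.
Import Order.TTheory GRing.Theory Num.Theory.
Local Open Scope ring_scope.

(** * Graph distance from a candidate function *)

Section Distance.
Variables (G : sgraph) (D : G -> G -> nat).
Hypothesis D_refl : forall x, D x x = 0%N.
Hypothesis D_eq0 : forall x y, D x y = 0%N -> x = y.
Hypothesis D_step :
  forall x y n, D x y = n.+1 -> exists2 z, adj x z & D z y = n.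
Hypothesis D_lip : forall x y z, adj x z -> (D x y <= (D z y).+1)%N.

Lemma shortest_walk x y :
  exists p, [/\ path (@adj G) x p, last x p = y & size p = D x y].
Proof.
move Dn: (D x y) => n; elim: n x Dn => [|n IHn] x Dxy.
  by exists [::]; split=> //=; exact: D_eq0.
have [z xz /IHn[p [zp pz sp]]] := D_step Dxy.
by exists (z :: p); split=> //=; rewrite ?xz // sp.
Qed.

Lemma walk_length_ge x p : path (@adj G) x p -> (D x (last x p) <= size p)%N.
Proof.
elim: p x => [|z p IHp] x /=; first by rewrite D_refl.
by move=> /andP[/D_lip xz /IHp]; rewrite -ltnS; apply: leq_trans.
Qed.

(** Descending with [D_step] gives a walk of length [D x y]; by [D_lip] no walk is shorter. *)
Lemma dist_eq x y : dist x y = Some (D x y).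
Proof.
have Dxy : walk_length x y (D x y) by apply/asboolP; exact: shortest_walk.
rewrite /dist; case: pselect => [h|[]]; last by exists (D x y).
congr Some; case: ex_minnP => m /asboolP[p [xp py <-]] mmin.
by apply/eqP; rewrite eqn_leq mmin //= -[in D x y]py walk_length_ge.
Qed.

End Distance.

(** * Acyclicity from a rank function *)

Lemma seq_argmax (T : eqType) (f : T -> int) (c : seq T) : c != [::] ->
  exists2 v, v \in c & forall x, x \in c -> f x <= f v.
Proof.
elim: c => // a c IHc _; have [->|/IHc[v vc vmax]] := eqVneq c [::].
  by exists a; rewrite ?mem_head // => x; rewrite inE => /eqP->.
have [av|va] := leP (f a) (f v).
  by exists v => [|x]; rewrite inE ?vc ?orbT // => /orP[/eqP->|/vmax].
exists a; rewrite ?mem_head // => x; rewrite inE => /orP[/eqP-> //|/vmax xv].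
exact: le_trans xv (ltW va).
Qed.

(* A vertex of maximal rank on a cycle has two distinct neighbours of at most
   its rank. *)
Lemma acyclic_of_rank (G : sgraph) (f : G -> int) :
  (forall v a b : G, adj v a -> adj v b -> f a <= f v -> f b <= f v -> a = b) ->
  acyclic_graph G.
Proof.
move=> rankP c /andP[cyc uniqc]; rewrite leqNgt; apply/negP => c3.
have c0 : c != [::] by case: c c3 {cyc uniqc}.
have [v vc vmax] := seq_argmax f c0.
have [i p rc] := rot_to vc.
have max_p x : x \in p -> f x <= f v.
  by move=> xp; apply: vmax; rewrite -(mem_rot i) rc inE xp orbT.
move: c3 cyc uniqc; rewrite -(size_rot i) -(rot_cycle i) -(rot_uniq i) rc /=.
case: p {rc} max_p => [|a p] //=; case/lastP: p => [|p b] // max_p _.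
rewrite rcons_path last_rcons => /andP[va /andP[_ bv]] /and3P[_ ap _].
move: ap; rewrite (rankP v a b va) ?mem_rcons ?mem_head // 1?adj_sym //.
- by apply: max_p; rewrite mem_head.
- by apply: max_p; rewrite inE mem_rcons mem_head orbT.
Qed.

(** * The comb as a locally finite tree *)

Definition comb_pos (u : comb) : int := match u with inl i | inr i => i end.

Definition comb_dist (u v : comb) : nat :=
  match u, v with
  | inl i, inl j => `|i - j|%N
  | inl i, inr j | inr i, inl j => `|i - j|.+1
  | inr i, inr j => if i == j then 0 else `|i - j|.+2
  end.

Lemma comb_dist_step (x y : comb) n : comb_dist x y = n.+1 ->
  exists2 z : comb, adj x z & comb_dist z y = n.
Proof.
have toward (i j : int) : i != j -> exists2 k : int,
    (k == i + 1) || (i == k + 1) & `|i - j|%N = `|k - j|.+1.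
  by move=> ij; exists (if i < j then i + 1 else i - 1); case: ifP; lia.
case: x y => [i|i] [j|j] /=.
- have [->|/toward[k ik ->]] := eqVneq i j; first by rewrite subrr.
  by case=> kj; exists (inl k).
- have [->|/toward[k ik ->]] := eqVneq i j.
    by rewrite subrr => -[<-]; exists (inr j) => //=; rewrite eqxx.
  by case=> kj; exists (inl k).
- by case=> ij; exists (inl i) => //=.
- by case: eqP => // _ [ij]; exists (inl i) => //=.
Qed.

Lemma comb_distE (u v : comb) : dist u v = Some (comb_dist u v).
Proof.
apply: dist_eq => [[]i|[]i[]j|x y n|[]i[]j[]k] /=; try (by lia).
- by rewrite eqxx.
- by move=> ?; congr inl; lia.
- by have [->|] := eqVneq i j.
- exact: comb_dist_step.
- by move=> /eqP->; have [->|] := eqVneq k j; lia.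
- by move=> /eqP->; have [->|] := eqVneq k j; lia.
Qed.

Lemma comb_connected : connected_graph comb.
Proof.
move=> x y; have := comb_distE x y; rewrite /dist.
case: pselect => // -[n /asboolP[p [xp py _]]] _.
by exists p.
Qed.

Lemma comb_acyclic : acyclic_graph comb.
Proof.
(* The only neighbour of x_i of at most its rank is x_(i-1); that of y_i is x_i. *)
pose rank (u : comb) := match u with inl i => 2 * i | inr i => 2 * i + 1 end.
apply: (@acyclic_of_rank comb rank) => -[]v []a []b //=; try lia.
all: by move=> *; congr inl; lia.
Qed.

Lemma comb_locally_finite : locally_finite comb.
Proof.
move=> x; pose i := comb_pos x.
apply: (@sub_finite_set _ _
  [set` [:: inl i; inl (i + 1); inl (i - 1); inr i : comb]]%classic).
  rewrite {}/i; case: x => i [] j //= ij; rewrite !inE.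
  - have [->|->] : j = i + 1 \/ j = i - 1 by lia.
    + by rewrite eqxx orbT.
    + by rewrite eqxx !orbT.
  - by rewrite (eqP ij) eqxx !orbT.
  - by rewrite (eqP ij) eqxx.
exact: finite_seq.
Qed.

(** * Excluding [hatT] *)

Lemma comb_branching_spine (v a b : comb) :
  adj v a -> adj v b -> a != b -> exists i, v = inl i.
Proof.
case: v => i; first by exists i.
by case: a b => [a|//] [b|//] /eqP<- /eqP<-; rewrite eqxx.
Qed.

(** The root and its three children all have two distinct neighbours, so they would embed in the
    spine, where a vertex has only two spine neighbours. *)
Lemma comb_hatT_free : induced_free hatT comb.
Proof.
case=> f f_inj f_adj.
pose o k (lt_k : (k < 10)%N) : hatT := Ordinal lt_k.
have spine (v a b : hatT) : adj v a -> adj v b -> a != b ->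
    exists i, f v = inl i.
  rewrite -!f_adj => va vb ab; apply: comb_branching_spine va vb _.
  by apply: contra_neq ab; exact: f_inj.
have [i0 f0] := @spine (@o 0 isT) (@o 1 isT) (@o 2 isT) isT isT isT.
have [i1 f1] := @spine (@o 1 isT) (@o 4 isT) (@o 5 isT) isT isT isT.
have [i2 f2] := @spine (@o 2 isT) (@o 6 isT) (@o 7 isT) isT isT isT.
have [i3 f3] := @spine (@o 3 isT) (@o 8 isT) (@o 9 isT) isT isT isT.
have := f_adj (@o 0 isT) (@o 1 isT); have := f_adj (@o 0 isT) (@o 2 isT).
have := f_adj (@o 0 isT) (@o 3 isT); rewrite f0 f1 f2 f3 /=.
have neq (a b : hatT) i j : f a = inl i -> f b = inl j -> a != b -> i != j.
  by move=> fa fb; apply: contra_neq => ij; apply: f_inj; rewrite fa fb ij.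
have := neq _ _ _ _ f1 f2 isT; have := neq _ _ _ _ f1 f3 isT.
have := neq _ _ _ _ f2 f3 isT.
rewrite /hatT_adj /=; lia.
Qed.

(** * The game on the comb *)

(** The two distances sum to j - a on the spine and to j - a + 2 at a leaf, so they reveal the kind
    of vertex and then its position. *)
Lemma comb_spine_probe (a j : int) (u v : comb) :
  a < comb_pos u < j -> a < comb_pos v < j ->
  comb_dist (inl a) u = comb_dist (inl a) v ->
  comb_dist (inl j) u = comb_dist (inl j) v -> u = v.
Proof.
by case: u v => [u|u] [v|v] /= *; [congr inl; lia | lia | lia | congr inr; lia].
Qed.

Lemma comb_one_probe (L : Type) (q : L -> comb) (i : int) :
  (forall l l' : L, l = l') ->
  exists jw : int * comb, let: (j, w) := jw in
  [/\ adj (inl i : comb) (inl j), adj (inl i : comb) w, w <> inl j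
    & forall l, dist (q l) (inl j) = dist (q l) w].
Proof.
move=> subL.
have single (u : comb) : exists jw : int * comb, let: (j, w) := jw in
    [/\ adj (inl i : comb) (inl j), adj (inl i : comb) w, w <> inl j
      & comb_dist u (inl j) = comb_dist u w].
  case: u => k.
  - have [ki|ik|->] := ltgtP k i.
    + by exists (i + 1, inr i); split=> //=; lia.
    + by exists (i - 1, inr i); split=> //=; lia.
    + by exists (i + 1, inr i); split=> //=; lia.
  - have [ki|ik|->] := ltgtP k i.
    + by exists (i + 1, inr i); split=> //=; rewrite ?(lt_eqF ki) //; lia.
    + by exists (i - 1, inr i); split=> //=; rewrite ?(gt_eqF ik) //; lia.
    (* A probe at y_i itself singles out y_i, but not x_(i+1) from x_(i-1). *)
    + by exists (i + 1, inl (i - 1)); split=> //=; [lia|lia|case; lia|lia].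
have [[l]|noL] := pselect (inhabited L).
  have [[j w] [ij iw wj eqjw]] := single (q l).
  by exists (j, w); split=> // l'; rewrite (subL l' l) !comb_distE eqjw.
exists (i + 1, inr i); split=> //= [|l]; first by lia.
by case: noL; exists.
Qed.

Lemma answers_ext (G : sgraph) (K : Type) (s : cop_strategy G K)
    (r r' : nat -> G) n :
  (forall m, (m < n)%N -> r m = r' m) -> answers s r n = answers s r' n.
Proof.
elim: n => //= n IHn rr'; rewrite IHn => [|m mn]; last exact/rr'/ltnW.
by rewrite rr'.
Qed.

Lemma comb_one_cop_loses (L : Type) :
  (forall l l' : L, l = l') -> ~ cops_win comb L.
Proof.
move=> subL [s s_wins].
have [f fP] := choice (fun hi : seq (answer L) * int =>
  comb_one_probe (s hi.1) hi.2 subL).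
(* A state holds the past answers and the robber's spine index. The initial index 0 is virtual:
   [r 0] is already a neighbour of x_0, chosen against the first probe. *)
pose next hi : seq (answer L) * int :=
  (rcons hi.1 (fun l => dist (s hi.1 l) (inl (f hi).1)), (f hi).1).
pose st n := iter n next ([::], 0).
pose r n : comb := inl (st n.+1).2.
have ansE n : answers s r n = (st n).1 by elim: n => //= n ->.
have stP n : [/\ adj (inl (st n).2 : comb) (r n),
    adj (inl (st n).2 : comb) (f (st n)).2, (f (st n)).2 <> r n
  & forall l, dist (s (st n).1 l) (r n) = dist (s (st n).1 l) (f (st n)).2].
  by have := fP (st n); rewrite /r /=; case: (f (st n)).
have [|n r_located] := s_wins r.
  by move=> n; right; case: (stP n.+1).
have [_ adj_w w_neq w_dist] := stP n.
(* The rival play copies [r] before round [n], then goes to the twin vertex [w] and stays there. *)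
pose w := (f (st n)).2; pose r' m := if (m < n)%N then r m else w.
have r'n : r' n = w by rewrite /r' ltnn.
apply: w_neq; rewrite -[LHS]/w -r'n; apply: r_located => [m|/=].
  rewrite /r'; have [mn|mn|mn] := ltngtP m.+1 n.
  - by right; case: (stP m.+1).
  - by left.
  - by right; move: adj_w; rewrite -[X in (st X).2]mn.
have -> : answers s r' n = answers s r n.
  by apply: answers_ext => m mn; rewrite /r' mn.
by rewrite r'n ansE; congr rcons; apply/funext => l; rewrite w_dist.
Qed.

(** One unit of the margin 2 covers the robber's move, the other makes the bounds strict. *)
Lemma comb_pos_bound (u v : comb) : v = u \/ adj u v ->
  - (comb_dist (inl 0) u).+2%:Z < comb_pos v < (comb_dist (inl 0) u).+2%:Z.
Proof.
case=> [->|]; first by case: u => i /=; lia.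
by case: u v => [i|i] [j|j] /=; lia.
Qed.

Lemma comb_two_cops_win : cops_win comb 'I_2.
Proof.
pose s : cop_strategy comb 'I_2 := fun h k =>
  if h is [:: a] then
    (* The default 0 is never reached, since all distances in the comb are finite. *)
    let d := (odflt 0%N (a ord0)).+2%:Z in inl (if k == ord0 then - d else d)
  else inl 0.
exists s => r r_play; exists 1%N => r' r'_play /= -[E E1].
(* Equal first answers make the second probes of both plays coincide. *)
have d0 : comb_dist (inl 0) (r' 0%N) = comb_dist (inl 0) (r 0%N).
  by have := congr1 (@^~ ord0) E; rewrite !comb_distE => -[].
pose d := (comb_dist (inl 0) (r 0%N)).+2%:Z.
have probe (k : 'I_2) (a : int) : (if k == ord0 then - d else d) = a ->
    comb_dist (inl a) (r' 1%N) = comb_dist (inl a) (r 1%N).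
  by move=> <-; have := congr1 (@^~ k) E1; rewrite !comb_distE d0 => -[].
apply: (@comb_spine_probe (- d) d).
- by rewrite /d -d0; exact: comb_pos_bound (r'_play 0%N).
- exact: comb_pos_bound (r_play 0%N).
- exact: (probe ord0).
- exact: (probe ord_max).
Qed.

Theorem theorem2p6 :
  [/\ is_tree comb, locally_finite comb, induced_free hatT comb
    & localization_number_is comb 'I_2].
Proof.
split.
- split; [exact: (inhabits (inl 0)) | exact: comb_connected |].
  exact: comb_acyclic.
- exact: comb_locally_finite.
- exact: comb_hatT_free.
split=> [|L L_wins]; first exact: comb_two_cops_win.
have [l [l' ll']] : exists l l' : L, l <> l'.
  apply: contrapT => no; apply: (@comb_one_cop_loses L _ L_wins) => l l'.
  by apply: contrapT => ll'; apply: no; exists l, l'.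
(* Two distinct cops give an injection of ['I_2] into [L]. *)
pose f (i : 'I_2) := if i == ord0 then l else l'.
have f_inj : {in [set: 'I_2]%classic &, injective f}.
  move=> [[|[|//]] ?] [[|[|//]] ?] _ _ E; apply/val_inj => //.
  by case: ll'; exact: esym E.
rewrite -(card_le_eql (inj_card_eq f_inj)); exact: card_leT.
Qed.
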